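(* Let $w\in\mathrm{F}(X_1,\ldots,X_d)$ be a nontrivial word of length at most $11$. Then there is a constant $L_w\in\mathbb{N}$ such that for every finite group $G$ satisfying the identity $w\equiv1$, one has $\lambda(G)\le L_w$.
   Context: $\mathrm{F}(X_1,\ldots,X_d)$ is the free group freely generated by $X_1,\ldots,X_d$; its elements are called words, and the length of a word is its reduced length with respect to $X_1,\ldots,X_d$. A group $G$ satisfies the identity $w\equiv1$ if $w(g_1,\ldots,g_d)=1$ for all $g_1,\ldots,g_d\in G$. The nonsolvable length $\lambda(G)$ of a finite group $G$ is the minimum number of nonsolvable factors in a normal series of $G$ each of whose factors is either solvable or a direct product of nonabelian finite simple groups. $\mathbb{N}$ includes $0$. *)

(* Defs.v *)
From HB Require Import structures.
From mathcomp Require Import all_boot all_fingroup all_solvable.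
From mathcomp Require Import boolp.

Set Implicit Arguments.
Unset Strict Implicit.
Unset Printing Implicit Defensive.

Local Open Scope group_scope.

(* The free group on 'I_d is the set of reduced sequences of letters, where   *)
(* the letter (i, false) is the generator of index i and (i, true) is its     *)
(* inverse. Lemmas evalM, eval_gen and eval_gen_unique below give its         *)
(* universal property.                                                        *)

Notation letter d := ('I_d * bool)%type.

Definition letter_inv d (a : letter d) : letter d := (a.1, ~~ a.2).

Definition reduced d (s : seq (letter d)) : bool :=
  sorted (fun a b => b != letter_inv a) s.

Record free_group (d : nat) := FreeGroup {
  free_word : seq (letter d);
  free_wordP : reduced free_word
}.

HB.instance Definition _ d := [isSub for @free_word d].
HB.instance Definition _ d := [Choice of free_group d by <:].

Section FreeGroupStructure.

Variable d : nat.
Implicit Types (a b : letter d) (s t : seq (letter d)) (u v w : free_group d).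

Definition letter_mul a s :=
  if s is b :: s' then if b == letter_inv a then s' else a :: s else [:: a].

Lemma letter_invK : involutive (@letter_inv d).
Proof. by case=> i b; rewrite /letter_inv /= negbK. Qed.

Lemma reduced_cons a s : reduced (a :: s) -> reduced s.
Proof. exact: path_sorted. Qed.

Lemma reduced_letter_mul a s : reduced s -> reduced (letter_mul a s).
Proof.
case: s => //= b s rs; case: ifPn => [_|ab]; first exact: path_sorted rs.
by rewrite /reduced /= ab.
Qed.

Lemma letter_mul_reduced a s : reduced (a :: s) -> letter_mul a s = a :: s.
Proof. by case: s => //= b s /andP[/negPf->]. Qed.

Lemma letter_mulK a s :
  reduced s -> letter_mul a (letter_mul (letter_inv a) s) = s.
Proof.
case: s => [|b s] rs /=; first by rewrite eqxx.
rewrite letter_invK; case: eqP => [eba|_] /=; last by rewrite eqxx.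
by rewrite eba in rs *; apply: letter_mul_reduced.
Qed.

Definition word_mul s t := foldr letter_mul t s.

Lemma reduced_word_mul s t : reduced t -> reduced (word_mul s t).
Proof. by move=> rt; elim: s => //= a s /reduced_letter_mul. Qed.

Lemma word_mul_letter a s t :
  reduced s -> reduced t ->
  word_mul (letter_mul a s) t = letter_mul a (word_mul s t).
Proof.
case: s => //= b s rs rt; case: eqP => //= -> {rs}.
by rewrite letter_mulK //; apply: reduced_word_mul.
Qed.

Lemma word_mulA s t r :
  reduced t -> reduced r ->
  word_mul s (word_mul t r) = word_mul (word_mul s t) r.
Proof.
move=> rt rr; elim: s => //= a s IHs.
by rewrite word_mul_letter ?IHs //; apply: reduced_word_mul.
Qed.

Lemma word_muls0 s : reduced s -> word_mul s [::] = s.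
Proof.
elim: s => //= a s IHs ras; rewrite IHs ?letter_mul_reduced //.
exact: reduced_cons ras.
Qed.

Definition word_inv s := rev (map (@letter_inv d) s).

Lemma word_invK : involutive word_inv.
Proof. by move=> s; rewrite /word_inv map_rev revK (mapK letter_invK). Qed.

Lemma reduced_word_inv s : reduced s -> reduced (word_inv s).
Proof.
rewrite /reduced rev_sorted sorted_map; apply: sub_sorted => a b /=.
by apply: contraNneq => ->; rewrite !letter_invK.
Qed.

Lemma word_mulVs s : word_mul (word_inv s) s = [::].
Proof.
elim: s => //= a s IHs.
by rewrite /word_mul /word_inv /= rev_cons foldr_rcons /= letter_invK eqxx.
Qed.

Lemma word_mulsV s : word_mul s (word_inv s) = [::].
Proof. by rewrite -{1}[s]word_invK word_mulVs. Qed.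

Definition free_one : free_group d := @FreeGroup d [::] isT.
Definition free_mul u v :=
  FreeGroup (reduced_word_mul (free_word u) (free_wordP v)).
Definition free_inv u := FreeGroup (reduced_word_inv (free_wordP u)).

Lemma free_mulA : associative free_mul.
Proof. by move=> u v w; apply/val_inj/word_mulA; apply: free_wordP. Qed.

Lemma free_mul1g : left_id free_one free_mul.
Proof. by move=> u; apply/val_inj. Qed.

Lemma free_mulg1 : right_id free_one free_mul.
Proof. by move=> u; apply/val_inj/word_muls0/free_wordP. Qed.

Lemma free_mulVg : left_inverse free_one free_inv free_mul.
Proof. by move=> u; apply/val_inj/word_mulVs. Qed.

Lemma free_mulgV : right_inverse free_one free_inv free_mul.
Proof. by move=> u; apply/val_inj/word_mulsV. Qed.

End FreeGroupStructure.

HB.instance Definition _ d := isGroup.Build (free_group d)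
  (@free_mulA d) (@free_mul1g d) (@free_mulg1 d) (@free_mulVg d) (@free_mulgV d).

Definition free_gen d (i : 'I_d) : free_group d :=
  @FreeGroup d [:: (i, false)] isT.

Definition word_length d (w : free_group d) : nat := size (free_word w).

Section Evaluation.

Variables (d : nat) (gT : groupType) (g : 'I_d -> gT).

Definition letter_eval (a : letter d) : gT := if a.2 then (g a.1)^-1 else g a.1.

Definition seq_eval (s : seq (letter d)) : gT := \prod_(a <- s) letter_eval a.

Definition eval (w : free_group d) : gT := seq_eval (free_word w).

Lemma letter_evalV a : letter_eval (letter_inv a) = (letter_eval a)^-1.
Proof. by case: a => i [] //=; rewrite /letter_eval /= invgK. Qed.

Lemma seq_eval_cons a s : seq_eval (a :: s) = letter_eval a * seq_eval s.
Proof. exact: big_cons. Qed.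

Lemma seq_eval_letter_mul a s :
  seq_eval (letter_mul a s) = letter_eval a * seq_eval s.
Proof.
case: s => [|b s] /=; first exact: seq_eval_cons.
case: eqP => [->|_]; rewrite !seq_eval_cons //.
by rewrite letter_evalV mulVKg.
Qed.

Lemma evalM : {morph eval : u v / u * v}.
Proof.
move=> [s rs] [t rt]; rewrite /eval /= /word_mul.
elim: s {rs} => [|a s IHs] /=; first by rewrite {2}/seq_eval big_nil mul1g.
by rewrite seq_eval_letter_mul IHs seq_eval_cons mulgA.
Qed.

Lemma eval_gen i : eval (free_gen i) = g i.
Proof. by rewrite /eval /seq_eval big_seq1. Qed.

Lemma eval_gen_unique (f : free_group d -> gT) :
  {morph f : u v / u * v} -> (forall i, f (free_gen i) = g i) -> f =1 eval.
Proof.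
move=> fM f_gen; have f1: f 1 = 1.
  by apply: (mulgI (f 1)); rewrite -fM !mulg1.
have f_letter i b (r : reduced [:: (i, b)]) :
    f (FreeGroup r) = letter_eval (i, b).
  case: b r => r; rewrite /letter_eval /= -f_gen; last first.
    by congr f; apply: val_inj.
  apply: (mulgI (f (free_gen i))); rewrite -fM mulgV -f1.
  by congr f; apply: val_inj; rewrite /= eqxx.
case=> s; elim: s => [|[i b] s IHs] r.
  by rewrite /eval /seq_eval big_nil -f1; congr f; apply: val_inj.
have sE : seq_eval s = f (FreeGroup (reduced_cons r)) by rewrite IHs.
rewrite /eval /= seq_eval_cons sE -(f_letter i b isT) -fM.
by congr f; apply: val_inj; rewrite /= letter_mul_reduced.
Qed.

End Evaluation.

Definition satisfies_identity (gT : finGroupType) (G : {group gT})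
    d (w : free_group d) : Prop :=
  forall g : 'I_d -> gT, (forall i, g i \in G) -> eval g w = 1.

Section NonsolvableLength.

Variable gT : finGroupType.
Implicit Types (G H K : {group gT}) (s : seq {group gT}).

Definition dprod_of_nonabelian_simple
    (rT : finGroupType) (A : {group rT}) : Prop :=
  exists2 S : seq {group rT},
    all (fun H : {group rT} => simple H && ~~ abelian H) S
    & \big[dprod/1]_(H <- S) (H : {set rT}) = A.

(* The consecutive pairs of terms of the series 1 :: s. *)
Definition steps s : seq ({group gT} * {group gT}) := zip (1%G :: s) s.

(* (G.-invariant).-series 1%G s means that each term of 1 :: s is normal in   *)
(* the next one and normalised by G; as the last term is G, every term is     *)
(* normal in G.                                                               *)
Definition admissible_series G s : Prop :=
  [/\ (G.-invariant).-series 1%G s, last 1%G s = G &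
      forall HK, HK \in steps s ->
        solvable (HK.2 / HK.1) \/ dprod_of_nonabelian_simple (HK.2 / HK.1)].

Definition nonsolvable_factors s : nat :=
  count (fun HK : {group gT} * {group gT} => ~~ solvable (HK.2 / HK.1)) (steps s).

Lemma charsimple_solvable_or_dprod (rT : finGroupType) (A : {group rT}) :
  charsimple A -> solvable A \/ dprod_of_nonabelian_simple A.
Proof.
move=> /charsimple_dprod[H [sHA simH [I /subsetP AutI defA]]].
have imE f : f \in I -> exists2 K : {group rT}, f @: H = K & K \isog H.
  move=> /AutI Af; exists (autm Af @* H)%G; last first.
    by rewrite isog_sym sub_isog ?injm_autm.
  by rewrite /= -{1}(autmE Af) -morphimEsub.
have [abH | nabH] := boolP (abelian H); [left | right].
  apply/abelian_sol; elim/big_rec: _ (A) defA => [_ <-|f B If IH_B M defM].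
    exact: abelian1.
  have [L defL isoL] := imE f If.
  have [[_ K _ defB] <- cfB _] := dprodP defM.
  rewrite defL defB in cfB *; rewrite abelianM (isog_abelian isoL) abH cfB andbT.
  exact: IH_B.
exists [seq [group of <<(f : {perm rT}) @: H>>] | f <- enum I].
  rewrite all_map; apply/allP=> f /=; rewrite mem_enum => /imE[L -> isoL].
  by rewrite genGid (isog_simple isoL) (isog_abelian isoL) simH.
rewrite big_map -[RHS]defA big_enum /=; apply: eq_bigr => f /imE[L -> _].
exact: genGid.
Qed.

Lemma admissible_series_exists G : exists s, admissible_series G s.
Proof.
have [s chs lasts] := chief_series_exists (normal_refl G); exists s.
split=> //; last first.
  move=> HK sHK; apply: charsimple_solvable_or_dprod.
  apply: (minnormal_charsimple (G:=(G / HK.1)%G)); apply: chief_factor_minnormal.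
  move: sHK; rewrite /steps; elim: s 1%G chs {lasts} => //= K s IHs H.
  by case/andP=> chHK /IHs{}IHs; rewrite inE => /predU1P[-> | /IHs].
apply: sub_path chs => H K /= /andP[/maxgroupp/andP[/proper_sub sHK nHG]].
case/andP=> sKG nKG; rewrite /invariant_factor nHG nKG /normal sHK.
exact: subset_trans sKG nHG.
Qed.

Lemma nonsolvable_length_ex G :
  exists n, `[< exists2 s, admissible_series G s & nonsolvable_factors s = n >].
Proof.
have [s adm_s] := admissible_series_exists G.
by exists (nonsolvable_factors s); apply/asboolP; exists s.
Qed.

Definition nonsolvable_length G : nat := ex_minn (nonsolvable_length_ex G).

End NonsolvableLength.

(* Main.v *)
(* Every finite group G satisfying a nontrivial word w of length at most 11 is
   solvable, so the nonsolvable length is 0.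

   If some variable has a nonzero exponent sum e in w, then G has exponent
   dividing e <= 11, hence an order with at most two prime divisors, and
   Burnside's p^a q^b theorem applies.  Otherwise each variable occurs an even
   number of times.  If x occurs exactly twice, then up to rotation
   w = x u x^-1 v with u, v free of x, so u takes central values in G and one
   concludes by induction with G / Z(G).  There remains, up to rotation, a word
   x^e1 y^a1 x^e2 y^a2 x^e3 y^a3 x^e4 y^a4 in two variables, with the signs
   + - + - or + + - - and |a1| + ... + |a4| <= 6.

   Let h be an r-element of G acting on an elementary abelian p-section E, with
   p and r distinct primes, and let A be the matrix of h.  Evaluating w in the
   affine group E <h> shows that A annihilates the Fox derivatives of w.
   Comparing with A^m = 1, where m is prime to p, this gives A = 1 either for
   all odd r, or for all p outside a set of at most two primes.  By Frobenius'
   normal complement theorem and Burnside's theorem, G is then solvable. *)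

Require Import Defs.
From mathcomp Require Import all_boot all_fingroup all_algebra all_solvable.
From mathcomp Require Import integral_char mxrepresentation mxabelem.
From mathcomp Require Import boolp.
From mathcomp Require Import zify ring.

Set Implicit Arguments.
Unset Strict Implicit.
Unset Printing Implicit Defensive.

Local Open Scope group_scope.

(** * Normal p-complements *)

Section NormalComplement.

Variable gT : finGroupType.
Implicit Types (G H K P Q X S T R : {group gT}).

Definition pr_centralized (p r : nat) (G : {set gT}) : Prop :=
  forall X g, X \subset G -> p.-group X -> g \in 'N_G(X) -> r.-elt g ->
  g \in 'C(X).

Definition p_centralized p (G : {set gT}) : Prop :=
  forall r, prime r -> r != p -> pr_centralized p r G.

Lemma p_centralizedS p G H :
  H \subset G -> p_centralized p G -> p_centralized p H.
Proof.
move=> sHG cG r r_pr neq_rp X g sXH pX; rewrite inE => /andP[Hg NXg] rg.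
apply: (cG r) => //; first exact: subset_trans sHG.
by rewrite inE NXg (subsetP sHG).
Qed.

Lemma p_centralized_norm p G X S :
  p_centralized p G -> X \subset G -> p.-group X ->
  p.-Sylow('N_G(X)) S -> S * 'C_G(X) = 'N_G(X).
Proof.
move=> cG sXG pX sylS; have nsCN : 'C_G(X) <| 'N_G(X).
  exact: subcent_normal.
have pNC : p.-group ('N_G(X) / 'C_G(X)).
  apply/pgroupP=> r r_pr; rewrite card_quotient ?normal_norm // => r_dv.
  apply: contraT => neq_rp.
  have [R sylR] := Sylow_exists r 'N_G(X).
  have sRC : R \subset 'C_G(X).
    apply/subsetP=> g Rg; have Ng := subsetP (pHall_sub sylR) g Rg.
    rewrite inE (subsetP (subsetIl _ _) _ Ng) (cG r) //.
    exact: mem_p_elt (pHall_pgroup sylR) Rg.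
  have := dvdn_trans r_dv (indexgS _ sRC).
  case/and3P: sylR => _ _ /(pnat_dvd _) => /[apply].
  by rewrite p'natE // dvdnn.
have sylSq := quotient_pHall (subset_trans (pHall_sub sylS) (normal_norm nsCN)) sylS.
have eS : S / 'C_G(X) = 'N_G(X) / 'C_G(X) by rewrite (pHall_id sylSq).
rewrite normC ?(subset_trans (pHall_sub sylS)) ?normal_norm //.
apply/eqP; rewrite eqEsubset mul_subG ?(normal_sub nsCN) ?(pHall_sub sylS) //=.
by rewrite -quotientSK ?eS // normal_norm.
Qed.

Lemma Sylow_conj_cent p G P Q :
  prime p -> p_centralized p G -> p.-Sylow(G) P -> p.-Sylow(G) Q ->
  exists2 c, c \in 'C_G(P :&: Q) & Q :=: P :^ c.
Proof.
move=> p_pr cG; move: {2}_.+1 (ltnSn (#|P| - #|P :&: Q|)) => n.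
elim: n P Q => // n IHn P Q; rewrite ltnS => le_n sylP sylQ.
have [sPG pP _] := and3P sylP; have [sQG pQ _] := and3P sylQ.
have cardPQ : #|P| = #|Q| by rewrite (card_Hall sylP) (card_Hall sylQ).
set D := (P :&: Q)%G; have [sDP sDQ] : D \subset P /\ D \subset Q.
  by rewrite subsetIl subsetIr.
have [eDP | neDP] := eqVneq #|D| #|P|.
  have /eqP eDP' : D :==: P by rewrite eqEcard sDP eDP leqnn.
  have /eqP eDQ' : D :==: Q by rewrite eqEcard sDQ eDP cardPQ leqnn.
  by exists 1; rewrite ?group1 // conjsg1 -eDP' -eDQ'.
have prDP : D \proper P by rewrite properEcard sDP ltn_neqAle neDP subset_leq_card.
have prDQ : D \proper Q.
  by rewrite properEcard sDQ ltn_neqAle -cardPQ neDP subset_leq_card.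
have pD := pgroupS sDP pP; have sDG := subset_trans sDP sPG.
have prDNP := nilpotent_proper_norm (pgroup_nil pP) prDP.
have prDNQ := nilpotent_proper_norm (pgroup_nil pQ) prDQ.
have [S sylS sNPS] := Sylow_superset (setSI 'N(D) sPG) (pgroupS (subsetIl _ _) pP).
have [T sylT sNQT] := Sylow_superset (setSI 'N(D) sQG) (pgroupS (subsetIl _ _) pQ).
have [x Nx defT] := Sylow_trans sylS sylT.
have := Nx; rewrite /= -(p_centralized_norm cG sDG pD sylS).
case/mulsgP=> s c Ss /setIP[Gc Cc] def_x.
rewrite {x Nx}def_x conjsgM conjGid // in defT.
have [R sylR sSR] := Sylow_superset (subset_trans (pHall_sub sylS) (subsetIl _ _))
  (pHall_pgroup sylS).
have sylRc : p.-Sylow(G) (R :^ c)%G by rewrite pHallJ.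
have lt_index P1 Q1 : p.-Sylow(G) P1 -> D \proper P1 :&: Q1 ->
    #|P1| - #|P1 :&: Q1| < n.
  move=> sylP1 /proper_card ltD; apply: leq_trans le_n.
  by rewrite (card_Hall sylP1) -(card_Hall sylP) ltn_sub2l // proper_card.
have prPR : D \proper P :&: R.
  by apply: proper_sub_trans prDNP _; rewrite subsetI subsetIl (subset_trans sNPS).
have prRQ : D \proper R :^ c :&: Q.
  apply: proper_sub_trans prDNQ _; rewrite subsetI subsetIl andbT.
  by rewrite (subset_trans sNQT) // defT conjSg.
have [u /setIP[Gu Cu] defR] := IHn P R (lt_index _ _ sylP prPR) sylP sylR.
have [v /setIP[Gv Cv] defQ] := IHn _ Q (lt_index _ _ sylRc prRQ) sylRc sylQ.
exists (u * c * v); last by rewrite !conjsgM -defR -defQ.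
rewrite inE; apply/andP; split; first by rewrite !groupM.
rewrite !groupM //.
  by apply: subsetP Cu; rewrite centS ?proper_sub.
by apply: subsetP Cv; rewrite centS ?proper_sub.
Qed.

Lemma Sylow_fusion p G P x g :
  prime p -> p_centralized p G -> p.-Sylow(G) P -> g \in G ->
  x \in P -> x ^ g \in P -> exists2 u, u \in P & x ^ g = x ^ u.
Proof.
move=> p_pr cG sylP Gg Px Pxg; have [sPG pP _] := and3P sylP.
have sylPg : p.-Sylow(G) (P :^ g)%G by rewrite pHallJ.
have [c /setIP[Gc Cc] defP] := Sylow_conj_cent p_pr cG sylPg sylP.
have xgc : x ^ (g * c) = x ^ g.
  rewrite conjgM; apply/conjg_fixP/commgP/esym; apply: (centP Cc).
  by rewrite inE Pxg memJ_conjg Px.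
have : g * c \in 'N_G(P).
  by rewrite !inE groupM //= conjsgM -defP.
rewrite -(@p_centralized_norm p G P P) ?Sylow_subnorm //.
case/mulsgP=> u k Pu /setIP[_ Ck] def_gc.
exists u => //; rewrite -xgc def_gc conjgM.
apply/conjg_fixP/commgP/esym; apply: (centP Ck).
by rewrite memJ_norm // (subsetP (normG P)).
Qed.

(* By Sylow_fusion the transfer to [P / P'] maps [g \in P] to the power of its
   class with exponent [#|G : P|], so its kernel is a proper subgroup to which
   induction applies. *)
Theorem Frobenius_pcore_Hall p G :
  prime p -> p_centralized p G -> p^'.-Hall(G) 'O_p^'(G).
Proof.
move=> p_pr; move: {2}_.+1 (ltnSn #|G|) => n.
elim: n G => // n IHn G; rewrite ltnS => leGn cG.
have [P sylP] := Sylow_exists p G; have [sPG pP p'iP] := and3P sylP.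
have [P1 | ntP] := eqVneq P 1%G.
  have p'G : p^'.-group G by move: p'iP; rewrite P1 indexg1.
  by rewrite pcore_pgroup_id // pHallE subxx part_pnat_id // eqxx.
pose alpha := restrm_morphism (der_norm 1 P) (coset_morphism P^`(1)).
have im_alpha : alpha @* P = P / P^`(1) by rewrite morphim_restrm setIid.
have abA : abelian (alpha @* P) by rewrite im_alpha der_abelian.
pose T := Morphism (transferM (G := G) abA).
have cardT : #|[set: FiniteModule.fmod_of abA]| = #|P / P^`(1)|.
  by rewrite cardsT card_sub -im_alpha.
pose K := 'ker T.
have pGK : p.-nat #|G : K|.
  have -> : #|G : K| = #|T @* G|.
    by rewrite card_morphim setIid.
  apply: pnat_dvd (cardSg (subsetT _)) _.
  rewrite cardT; exact: quotient_pgroup.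
have nsKG : K <| G := ker_normal T.
have prKG : K \proper G.
  rewrite properE normal_sub //; apply/subsetPn.
  have : P^`(1) \proper P.
    by rewrite (sol_der1_proper (nilpotent_sol (pgroup_nil pP))) // subxx.
  case/properP=> _ [g Pg P'g]; have Gg := subsetP sPG g Pg; exists g => //.
  apply: contra P'g => /(kerP T Gg) /= Tg1.
  have trX := transversalP (rcosets_cycle_partition sPG Gg).
  set X := transversal _ _ in trX.
  have alphaX x : x \in X ->
    restrm (transfer_morph_subproof alpha) (FiniteModule.fmod abA \o alpha)
      ((g ^+ #|<[g]> : P :* x|) ^ x^-1) =
    GRing.natmul (FiniteModule.fmod abA (alpha g)) #|<[g]> : P :* x|.
    move=> Xx; have Gx := subsetP (transversal_sub trX) x Xx.
    set m := #|_ : _|; have Pgm : g ^+ m \in P by rewrite groupX.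
    have Pgmx : (g ^+ m) ^ x^-1 \in P.
      have := mulg_exp_card_rcosets P g x; rewrite -/m mem_rcoset.
      by rewrite conjgE invgK mulgA.
    have [u Pu ->] := Sylow_fusion p_pr cG sylP (groupVr Gx) Pgm Pgmx.
    rewrite /= -FiniteModule.fmodX ?mem_morphim //; congr FiniteModule.fmod.
    rewrite morphJ // morphX //.
    apply/conjg_fixP/commgP/(centsP abA); first by rewrite groupX ?mem_morphim.
    by rewrite mem_morphim.
  have := transfer_cycle_expansion sPG abA Gg trX.
  rewrite Tg1 (eq_bigr _ alphaX) GRing.sumrMnr (sum_index_rcosets_cycle sPG Gg trX).
  have Aag : alpha g \in alpha @* P by rewrite mem_morphim.
  rewrite -FiniteModule.fmodX // => /(congr1 \val).
  rewrite FiniteModule.fmodK ?groupX // => /esym ag1.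
  have coAi : coprime #|alpha @* P| #|G : P|.
    apply: (@pnat_coprime p) => //.
    by rewrite im_alpha; apply: quotient_pgroup.
  have /= := expgK coAi Aag; rewrite ag1 expg1n => /esym/coset_idr -> //.
  exact: subsetP (der_norm 1 P) g Pg.
have cK : p_centralized p K := p_centralizedS (normal_sub nsKG) cG.
have hallK := IHn _ (leq_trans (proper_card prKG) leGn) cK.
have sOO : 'O_p^'(K) \subset 'O_p^'(G).
  by rewrite pcore_max ?pcore_pgroup // (gFnormal_trans _ nsKG).
apply/and3P; split; rewrite ?pcore_sub ?pcore_pgroup //.
rewrite pnatNK; apply: pnat_dvd (indexgS G sOO) _.
rewrite -(Lagrange_index (normal_sub nsKG) (pcore_sub _ _)) pnatM.
by case/and3P: hallK => _ _; rewrite pnatNK pGK => ->.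
Qed.

Lemma sol_p_centralized_primes G (Q : {pred nat}) :
  (forall p, prime p -> p \in Q -> p_centralized p G) ->
  size [seq p <- primes #|G| | p \notin Q] <= 2 -> solvable G.
Proof.
move: {2}_.+1 (ltnSn #|G|) => n; elim: n G => // n IHn G; rewrite ltnS => leGn cG.
have [/hasP[p pG Qp] | noQ] := boolP (has [in Q] (primes #|G|)); last first.
  rewrite (_ : [seq p <- _ | _] = primes #|G|); first exact: Burnside_p_a_q_b.
  by apply/all_filterP; rewrite all_predC.
move: pG; rewrite mem_primes => /and3P[p_pr _ p_dv] le2.
have hallO := Frobenius_pcore_Hall p_pr (cG p p_pr Qp).
rewrite (series_sol (pcore_normal p^' G)); apply/andP; split; last first.
  apply/nilpotent_sol/(@pgroup_nil _ p); rewrite /pgroup card_quotient ?gFnorm //.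
  by case/and3P: hallO => _ _; rewrite pnatNK.
apply: IHn => [|q q_pr Qq|].
- apply: leq_trans leGn; apply: proper_card; rewrite properE pcore_sub.
  apply/negP=> /pgroupS/(_ (pcore_pgroup _ _)); rewrite /pgroup => /pnatP.
  by move/(_ (cardG_gt0 _) p p_pr p_dv); rewrite !inE eqxx.
- exact: p_centralizedS (pcore_sub _ _) (cG q q_pr Qq).
apply: leq_trans le2; apply: uniq_leq_size; first by rewrite filter_uniq ?primes_uniq.
move=> q; rewrite !mem_filter !mem_primes !cardG_gt0 => /and3P[-> -> /= q_dv].
exact: dvdn_trans q_dv (cardSg (pcore_sub _ _)).
Qed.

Lemma sol_odd_pr_centralized G :
  (forall p r, prime p -> prime r -> r != p -> r != 2 -> pr_centralized p r G) ->
  solvable G.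
Proof.
move=> cG; have c2G : p_centralized 2 G by move=> r r_pr r2; apply: cG.
have hallO := Frobenius_pcore_Hall (isT : prime 2) c2G.
rewrite (series_sol (pcore_normal 2^' G)); apply/andP; split; last first.
  apply/nilpotent_sol/(@pgroup_nil _ 2); rewrite /pgroup card_quotient ?gFnorm //.
  by case/and3P: hallO => _ _; rewrite pnatNK.
apply: (@sol_p_centralized_primes _ predT) => [p p_pr _ r r_pr neq_rp X g sXO pX|].
  move=> NOXg rg; have [Og NXg] := setIP NOXg.
  have [r2 | neq_r2] := eqVneq r 2.
    have g1 : g \in [1].
      rewrite inE -order_eq1; apply/eqP.
      rewrite r2 in rg; apply: (pnat_1 rg).
      exact: mem_p_elt (pcore_pgroup _ _) Og.
    by rewrite (set1P g1) group1.
  have sOG := pcore_sub 2^' G.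
  apply: (cG p r) => //; first exact: subset_trans sOG.
  by rewrite inE NXg (subsetP sOG).
by rewrite (eq_filter (a2 := pred0)) ?filter_pred0.
Qed.

End NormalComplement.

(** * Units of finite order in characteristic p *)

Section UnipotentCoprime.

Import GRing.Theory.
Local Open Scope ring_scope.

Lemma mulrB1B1 (R : pzRingType) (x y : R) :
  ((x - 1) * (y - 1) = 1 - x + x * y - y)%R.
Proof.
rewrite mulrBl !mulrBr mul1r !mulr1 opprB.
rewrite addrC addrA addrAC (addrAC 1%R).
by rewrite addrAC.
Qed.

(* Here [u], [v], [w] are powers of [x]; the two equations are the Fox derivatives
   of a law and of its image under the substitution [x := x * y]. *)
Lemma fox_paired_factor (R : unitRingType) (x u v w : R) :
  (u \is a GRing.unit -> 1 + u - u * v - w = 0 ->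
   1 + u * x - u * x * v - w = 0 -> (x - 1) * (v - 1) = 0)%R.
Proof.
move=> Uu e1; rewrite -mulrA => e2; have /addIr := etrans e2 (esym e1).
rewrite -!addrA => /addrI /eqP.
rewrite -subr_eq0 => /eqP eq_u; apply: (mulrI Uu).
rewrite mulr0 -[RHS]oppr0 -eq_u opprB.
rewrite mulrBl mul1r !mulrBr !mulr1 !opprB.
by rewrite [RHS]addrC.
Qed.

Lemma fox_paired_unipotent (R : unitRingType) (x : R) (b d : int) :
  (x \is a GRing.unit -> (forall y : R, b%:~R * y = 0 -> y = 0) ->
   b%:~R * x ^+ 2 - (b + d)%:~R * x + d%:~R = 0 ->
   b%:~R * x ^+ 4 - (b + d)%:~R * x ^+ 2 + d%:~R = 0 ->
   (x ^+ 2 - 1) ^+ 2 = 0)%R.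
Proof.
move=> Ux b_inj eq1 eq2; apply: (mulrI Ux); rewrite mulr0; apply: b_inj.
have cx : commr_rmorph (intr : int -> R) x.
  by move=> n; exact: commr_int.
pose f : {rmorphism {poly int} -> R} := horner_morph cx.
pose p1 := (b%:P * 'X ^+ 2 - (b + d)%:P * 'X + d%:P : {poly int})%R.
pose p2 := (b%:P * 'X ^+ 4 - (b + d)%:P * 'X ^+ 2 + d%:P : {poly int})%R.
have f1 : f p1 = 0%R.
  by rewrite /p1 rmorphD rmorphB !rmorphM /= !horner_morphX !horner_morphC.
have f2 : f p2 = 0%R.
  by rewrite /p2 rmorphD rmorphB !rmorphM /= !horner_morphX !horner_morphC.
have : f (('X + 1) * (p2 - ('X + 1) * p1)) = 0.
  by rewrite rmorphM rmorphB [f (_ * p1)]rmorphM f1 f2 mulr0 subr0 mulr0.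
have -> : ('X + 1) * (p2 - ('X + 1) * p1) = b%:P * ('X * ('X ^+ 2 - 1) ^+ 2).
  by rewrite /p1 /p2 polyCD; ring.
rewrite !rmorphM !rmorphB !rmorphM rmorph1 /= horner_morphX.
by rewrite horner_morphC.
Qed.

Lemma coprime_order_exprz (R : unitRingType) (x : R) (a : int) m :
  x \is a GRing.unit -> (0 < m)%N -> x ^+ m = 1 -> coprime m `|a| ->
  exists n : nat, x = (x ^ a) ^+ n.
Proof.
move=> Ux m_gt0 xm1 co_ma.
have [[u v] /= uv1] : exists uv : int * int, uv.1 * m%:Z + uv.2 * a = 1.
  by apply/coprimezP; rewrite coprimezE.
have xmz (w : int) : x ^ (m%:Z * w) = 1 by rewrite -exprz_exp -exprnP xm1 exp1rz.
have m_neq0 : m%:Z != 0 by lia.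
exists `|(v %% m)%Z|%N; rewrite [RHS]exprnP gez0_abs ?modz_ge0 // exprz_exp.
have -> : a * (v %% m)%Z = 1 + m%:Z * (- u - a * (v %/ m)%Z).
  have v_eq := divz_eq v m; rewrite -uv1.
  by move: (v %% m)%Z (v %/ m)%Z v_eq => r q ->; ring.
by rewrite exprzDr // xmz mulr1 expr1z.
Qed.

Variables (R : unitRingType) (p : nat).
Hypothesis charRp : p \in [pchar R].

Lemma unipotent_coprime_order (x : R) m :
  (x - 1) ^+ 2 = 0 -> x ^+ m = 1 -> coprime m p -> x = 1.
Proof.
move=> x1_2 xm1 co_mp; have p_pr := pcharf_prime charRp.
have xp1 : x ^+ p = 1.
  have := pFrobenius_autB_comm charRp (commr1 x).
  rewrite !pFrobenius_autE expr1n => xp; apply/eqP; rewrite -subr_eq0 -xp.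
  by rewrite -(subnK (prime_gt1 p_pr)) exprD x1_2 mulr0.
have [m0|m_gt0] := posnP m.
  by rewrite m0 /coprime gcd0n in co_mp; rewrite (eqP co_mp) in p_pr.
have [[u v] /= uv1] := coprimeP p m_gt0 co_mp.
have := congr1 (fun y => y ^+ u) xm1; rewrite expr1n -exprM => xmu.
have -> : x = x ^+ (m * u) by rewrite (_ : m * u = 1 + p * v)%N; [
  rewrite exprD exprM xp1 expr1n mulr1 | lia].
by [].
Qed.

(* Both [x ^ a] and [x ^ b] generate the same cyclic group as [x], so [x - 1]
   is a multiple of [x ^ a - 1] and of [x ^ b - 1], and its square vanishes. *)
Lemma coprime_orders_mul_eq0 (x : R) (a b : int) m :
  x \is a GRing.unit -> (0 < m)%N -> (x ^ a - 1) * (x ^ b - 1) = 0 ->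
  x ^+ m = 1 -> coprime m p -> coprime m `|a| -> coprime m `|b| -> x = 1.
Proof.
move=> Ux m_gt0 xab xm1 co_mp co_ma co_mb.
have [k def_xa] := coprime_order_exprz Ux m_gt0 xm1 co_ma.
have [l def_xb] := coprime_order_exprz Ux m_gt0 xm1 co_mb.
apply: (unipotent_coprime_order _ xm1 co_mp); rewrite expr2.
rewrite {1}def_xa {2}def_xb !subrX1.
set S := \sum_(_ < k) _; have /commr_sym -> : GRing.comm S (x ^ a - 1).
  apply/commr_sym/commr_sum => i _; apply/commr_sym/commrB; last exact: commr1.
  by apply/commr_sym/commrX.
by rewrite -mulrA (mulrA (_ - 1)) xab mul0r mulr0.
Qed.

End UnipotentCoprime.

(** * Two-variable laws with four blocks *)

Section IntegerPowers.

Variable gT : finGroupType.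
Implicit Types (x y : gT) (a b : int) (G : {group gT}).

Definition zexpg x a := match a with Posz n => x ^+ n | Negz n => x ^- n.+1 end.

Lemma zexpg_in G x a : x \in G -> zexpg x a \in G.
Proof. by case: a => n Gx /=; rewrite ?groupV groupX. Qed.

Lemma zexpVg x a : zexpg x^-1 a = (zexpg x a)^-1.
Proof. by case: a => n /=; rewrite expVgn. Qed.

Lemma zexp1g a : zexpg 1 a = 1.
Proof. by case: a => n /=; rewrite expg1n ?invg1. Qed.

Lemma zexpgD x a b : zexpg x (a + b)%R = zexpg x a * zexpg x b.
Proof.
have succ c : zexpg x (c + 1)%R = zexpg x c * x.
  case: c => [n|[|n]]; first by rewrite -PoszD addn1 /= expgSr.
    by rewrite /= mulVg.
  rewrite (_ : (Negz n.+1 + 1)%R = Negz n) /=; last by rewrite !NegzE; lia.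
  by rewrite [in RHS]expgS invMg mulgKV.
elim/int_rec: b => [|n IHn|n IHn]; first by rewrite GRing.addr0 mulg1.
  by rewrite -addn1 PoszD GRing.addrA !succ IHn mulgA.
apply: (mulIg x); rewrite -succ -mulgA -succ.
by rewrite -GRing.addrA (_ : (- n.+1%:Z + 1)%R = (- n%:Z)%R) //; lia.
Qed.

Lemma zexpgN1 x : zexpg x (-1)%R = x^-1.
Proof. by []. Qed.

End IntegerPowers.

Lemma morph_zexpg (aT rT : finGroupType) (D : {group aT}) (f : {morphism D >-> rT}) x a :
  x \in D -> f (zexpg x a) = zexpg (f x) a.
Proof. by case: a => n Dx /=; rewrite ?morphV ?groupX // morphX. Qed.

Definition block_law (gT : finGroupType) (G : {set gT})
    (e1 e2 e3 e4 a1 a2 a3 a4 : int) : Prop :=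
  forall x y, x \in G -> y \in G ->
  zexpg x e1 * zexpg y a1 * zexpg x e2 * zexpg y a2 *
  zexpg x e3 * zexpg y a3 * zexpg x e4 * zexpg y a4 = 1.

Section AffineAction.

Import GRing.Theory.
Local Open Scope ring_scope.

Lemma mulmx_intr (R : pzRingType) m n (v : 'rV[R]_m) (e : int)
    (M : 'M[R]_(m, n)) :
  v *m (M *~ e) = (v *~ e) *m M.
Proof. by rewrite (raddfMz (mulmx v)) -[RHS]/(mulmxr M (v *~ e)) raddfMz. Qed.

Variables (gT : finGroupType) (p : nat) (L E : {group gT}).
Hypotheses (p_pr : prime p) (abE : (p.-abelem E)%g) (ntE : E :!=: 1%g).
Hypotheses (sEL : E \subset L) (nEL : (L \subset 'N(E))%g).

Local Notation rL := (abelem_repr abE ntE nEL).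
Local Notation rV := (rVabelem abE ntE).

Lemma rVabelem_in v : rV v \in L.
Proof. by rewrite (subsetP sEL) ?mem_rVabelem. Qed.

Lemma repr_zexpg h a : h \in L -> rL (zexpg h a) = rL h ^ a.
Proof.
move=> Lh; case: a => n /=; first by rewrite repr_mxX.
by rewrite repr_mxV ?groupX // repr_mxX.
Qed.

Lemma zexpg_rVabelem v a : zexpg (rV v) a = rV (v *~ a).
Proof.
have rVX n : (rV v ^+ n)%g = rV (v *+ n).
  by elim: n => [|n IHn]; rewrite ?rVabelem0 // mulrS rVabelemD -IHn expgS.
by case: a => n /=; rewrite rVX //  -rVabelemN.
Qed.

Section OneElement.

Variable h : gT.
Hypothesis Lh : h \in L.
Let A := rL h.

(* [h^-1] rather than [h], because [rL] is a right action. *)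
Definition affine v (k : int) : gT := (rV v * zexpg h^-1 k)%g.

Lemma affineM v w k l :
  (affine v k * affine w l)%g = affine (v + w *m A ^ k) (k + l).
Proof.
rewrite /affine zexpgD rVabelemD -repr_zexpg // rVabelemJ ?zexpg_in //.
by rewrite zexpVg conjgE !mulgA mulgK.
Qed.

Lemma affine_eq1 v : affine v 0 = 1%g -> v = 0.
Proof.
by rewrite /affine mulg1 -(rVabelem0 abE ntE) => /rVabelem_inj.
Qed.

Section Law.

Variables e1 e2 e3 e4 a1 a2 a3 a4 : int.
Hypothesis lawL : block_law L e1 e2 e3 e4 a1 a2 a3 a4.

(* The law at [x = v], [y = h^-1] in [E <h>]; the left-hand side is the Fox
   derivative with respect to [x]. *)
Lemma block_law_fox_x : a1 + a2 + a3 + a4 = 0 ->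
  e1%:~R + e2%:~R * A ^ a1 + e3%:~R * A ^ (a1 + a2) +
    e4%:~R * A ^ (a1 + a2 + a3) = 0.
Proof.
move=> a0; apply/row_matrixP=> i; rewrite row0 rowE.
set v := delta_mx 0 i; have Lhi : (h^-1)%g \in L by rewrite groupV.
have := lawL (rVabelem_in v) Lhi; rewrite !zexpg_rVabelem.
have -> t1 t2 t3 t4 : (rV t1 * zexpg h^-1 a1 * rV t2 * zexpg h^-1 a2 *
    rV t3 * zexpg h^-1 a3 * rV t4 * zexpg h^-1 a4 =
    affine t1 a1 * affine t2 a2 * affine t3 a3 * affine t4 a4)%g.
  by rewrite /affine !mulgA.
rewrite !affineM a0 => /affine_eq1 <-.
by rewrite !mulmxDr !mulrzl !mulmx_intr mulmx1.
Qed.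

(* The law at [x = h^-1], [y = v]. *)
Lemma block_law_fox_y : e1 + e2 + e3 + e4 = 0 ->
  a1%:~R * A ^ e1 + a2%:~R * A ^ (e1 + e2) + a3%:~R * A ^ (e1 + e2 + e3) +
    a4%:~R = 0.
Proof.
move=> e0; apply/row_matrixP=> i; rewrite row0 rowE.
set v := delta_mx 0 i; have Lhi : (h^-1)%g \in L by rewrite groupV.
have := lawL Lhi (rVabelem_in v); rewrite !zexpg_rVabelem.
have -> t1 t2 t3 t4 : (zexpg h^-1 e1 * rV t1 * zexpg h^-1 e2 * rV t2 *
    zexpg h^-1 e3 * rV t3 * zexpg h^-1 e4 * rV t4 =
    affine 0 e1 * affine t1 e2 * affine t2 e3 * affine t3 e4 * affine t4 0)%g.
  by rewrite /affine rVabelem0 mul1g mulg1 !mulgA.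
rewrite !affineM e0 add0r addr0 => /affine_eq1 <-.
by rewrite !mulmxDr !mulrzl !mulmx_intr mulmx1.
Qed.

End Law.

End OneElement.

Lemma pchar_abelem_mx : p \in [pchar 'M['F_p](E)].
Proof. by rewrite pchar_lalg pchar_Fp. Qed.

Lemma intr_mul_mx_eq0 (n : int) (X : 'M['F_p](E)) :
  ~~ (p %| `|n|)%N -> n%:~R * X = 0 -> X = 0.
Proof.
move=> p'n; rewrite mulrzl -scaler_int => /eqP; rewrite scaler_eq0.
rewrite -(dvdz_pcharf (pchar_Fp p_pr)) dvdzE absz_nat (negPf p'n) /=.
by move/eqP.
Qed.

Variable h : gT.
Hypothesis Lh : h \in L.
Local Notation A := (rL h).

Lemma abelem_repr_eq1 : A = 1 -> h \in 'C(E)%g.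
Proof.
move=> A1; apply/centP=> x Ex; apply: commute_sym; apply/commgP/conjg_fixP.
by rewrite -(abelem_rV_K abE ntE Ex) -(rVabelemJ abE ntE nEL) // A1 mulmx1.
Qed.

Section CoprimeAction.

Variable r : nat.
Hypotheses (r_pr : prime r) (neq_rp : r != p) (rh : r.-elt h).

Let m := #[h]%g.

Lemma abelem_repr_unit : A \is a GRing.unit.
Proof. exact: repr_mx_unitr. Qed.

Lemma abelem_repr_exp_order : A ^+ m = 1.
Proof. by rewrite -repr_mxX // expg_order repr_mx1. Qed.

Lemma coprime_elt_order n : ~~ (r %| n)%N -> coprime m n.
Proof. by move=> r'n; apply: (pnat_coprime rh); rewrite p'natE. Qed.

Lemma coprime_elt_order_p : coprime m p.
Proof. by apply: coprime_elt_order; rewrite dvdn_prime2. Qed.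

Variables a1 a2 a3 a4 : int.
Hypothesis sum_a : a1 + a2 + a3 + a4 = 0.

Lemma alternating_law_cent_p :
  block_law L 1 (-1) 1 (-1) a1 a2 a3 a4 -> ~~ (p %| `|(a1 + a3)%R|)%N -> A = 1.
Proof.
move=> lawL p'a; have := block_law_fox_y Lh lawL erefl; rewrite subrr add0r.
rewrite expr0z expr1z mulr1 [_ + a3%:~R * _]addrAC -mulrDl -rmorphD -addrA -rmorphD.
have -> : a2 + a4 = - (a1 + a3).
  by apply/eqP; rewrite -subr_eq0 -sum_a; apply/eqP; ring.
rewrite rmorphN -[X in _ - X]mulr1 -mulrBr => /(intr_mul_mx_eq0 p'a)/eqP.
by rewrite subr_eq0 => /eqP.
Qed.

Lemma alternating_law_cent_r :
  block_law L 1 (-1) 1 (-1) a1 a2 a3 a4 -> a1 + a3 = 0 ->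
  ~~ (r %| `|a1|)%N -> ~~ (r %| `|a2|)%N -> A = 1.
Proof.
move=> lawL a13 r'a1 r'a2; have Ux := abelem_repr_unit.
have := block_law_fox_x Lh lawL sum_a.
have -> : a1 + a2 + a3 = a2 by rewrite addrAC a13 add0r.
rewrite exprzDr // !mulrN1z !mulr1z !mulN1r !mul1r => foxA.
apply: (coprime_orders_mul_eq0 (a := a1) (b := a2) pchar_abelem_mx Ux
  (order_gt0 h) _ abelem_repr_exp_order coprime_elt_order_p); rewrite ?coprime_elt_order //.
by rewrite mulrB1B1.
Qed.

Lemma paired_law_cent_r :
  block_law L 1 1 (-1) (-1) a1 a2 a3 a4 -> ~~ (r %| `|a2|)%N -> A = 1.
Proof.
move=> lawL r'a2; have UA := abelem_repr_unit.
have lawL' : block_law L 1 1 (-1) (-1) (a1 + 1) a2 (a3 - 1) a4.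
  move=> x y Lx Ly; rewrite -[RHS](lawL (x * y)%g y) ?groupM // [a1 + 1]addrC.
  have y_y2 : (y * zexpg y a2 * y^-1 = zexpg y a2)%g.
    by rewrite -{1}[y]/(zexpg y 1) -(zexpgN1 y) -!zexpgD addrAC subrr add0r.
  by rewrite !zexpgD !zexpgN1 /= !expg1 invMg -{1}y_y2 !mulgA.
have sum_a' : a1 + 1 + a2 + (a3 - 1) + a4 = 0 by rewrite -sum_a; ring.
have eq1 := block_law_fox_x Lh lawL sum_a.
have := block_law_fox_x Lh lawL' sum_a'.
have -> : a1 + 1 + a2 + (a3 - 1) = a1 + a2 + a3 by ring.
move: eq1; rewrite !mulrN1z !mulr1z !mulN1r !mul1r !(exprzDr UA).
rewrite !expr1z => eq1 eq2.
have A_a2 := fox_paired_factor (unitrXz _ UA) eq1 eq2.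
apply: (coprime_orders_mul_eq0 (a := 1) (b := a2) pchar_abelem_mx UA
  (order_gt0 h) _ abelem_repr_exp_order coprime_elt_order_p); rewrite ?coprime_elt_order //.
by rewrite dvdn1; case: r r_pr => [|[]].
Qed.

Lemma paired_law_cent_p :
  block_law L 1 1 (-1) (-1) a1 a2 a3 a4 -> ~~ (p %| `|a2|)%N -> (r != 2)%N -> A = 1.
Proof.
move=> lawL p'a2 r2; have UA := abelem_repr_unit.
have foxL g : g \in L ->
    a2%:~R * rL g ^+ 2 - (a2 + a4)%:~R * rL g + a4%:~R = 0.
  move=> Lg; have := block_law_fox_y Lg lawL erefl.
  have -> : a2 + a4 = - (a1 + a3).
    by apply/eqP; rewrite -subr_eq0 -sum_a; apply/eqP; ring.
  rewrite -[1 + 1 - 1 : int]/(1 : int) expr1z rmorphN mulNr opprK.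
  by rewrite rmorphD mulrDl addrA [_ * _ ^+ 2 + _]addrC.
have A2_unip : (A ^+ 2 - 1) ^+ 2 = 0.
  apply: (@fox_paired_unipotent _ _ a2 a4 UA) => [y||].
  - exact: intr_mul_mx_eq0.
  - exact: foxL.
  by rewrite (exprM A 2 2) -repr_mxX //; apply: foxL; rewrite groupX.
have A2 : A ^+ 2 = 1.
  apply: (unipotent_coprime_order pchar_abelem_mx A2_unip _ coprime_elt_order_p).
  by rewrite exprAC abelem_repr_exp_order expr1n.
have co_m2 : coprime m 2 by apply: coprime_elt_order; rewrite dvdn_prime2.
have [n] := coprime_order_exprz (a := 2) UA (order_gt0 h) abelem_repr_exp_order co_m2.
by rewrite -exprnP A2 expr1n.
Qed.

End CoprimeAction.

End AffineAction.

Lemma coprime_cent_Phi (gT : finGroupType) (p : nat) (X A : {group gT}) :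
  p.-group X -> A \subset 'N(X) -> coprime #|X| #|A| ->
  A / 'Phi(X) \subset 'C(X / 'Phi(X)) -> A \subset 'C(X).
Proof.
move=> pX nXA co_XA cXA; have sPX := Phi_sub X.
have nPA : A \subset 'N('Phi(X)) by rewrite (char_norm_trans (Phi_char X)).
have nPX := normal_norm (Phi_normal X).
have := coprime_quotient_cent sPX nPA co_XA (nilpotent_sol (pgroup_nil pX)).
have -> : 'C_(X / 'Phi(X))(A / 'Phi(X)) = X / 'Phi(X).
  by apply/setIidPl; rewrite centsC.
move=> eqC; have sX : X \subset 'Phi(X) * 'C_X(A) by rewrite -quotientSK // eqC.
 rewrite centsC -{1}(@Phi_nongen _ X 'C_X(A)) ?gen_subG ?subsetIr //.
apply/eqP; rewrite eqEsubset join_subG sPX subsetIl.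
by apply: subset_trans sX _; rewrite mulG_subG joing_subl joing_subr.
Qed.

Section BlockLaw.

Variables e1 e2 e3 e4 a1 a2 a3 a4 : int.

Local Notation law G := (block_law G e1 e2 e3 e4 a1 a2 a3 a4).

Lemma block_lawS (gT : finGroupType) (G H : {set gT}) :
  H \subset G -> law G -> law H.
Proof. by move=> /subsetP sHG lawG x y Hx Hy; apply: lawG; apply: sHG. Qed.

Lemma block_law_quotient (gT : finGroupType) (G H : {group gT}) :
  law G -> law (G / H).
Proof.
move=> lawG _ _ /morphimP[x Nx Gx ->] /morphimP[y Ny Gy ->].
have Nz z a : z \in 'N(H) -> zexpg z a \in 'N(H) by apply: zexpg_in.
rewrite -!(morph_zexpg (coset_morphism H)) // -!morphM ?groupM ?Nz //.
by rewrite lawG // morph1.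
Qed.

Lemma block_law_rotation (gT : finGroupType) (G : {set gT}) :
  law G -> block_law G e2 e3 e4 e1 a2 a3 a4 a1.
Proof.
move=> lawG x y Gx Gy; apply: (mulgI (zexpg x e1 * zexpg y a1)).
by rewrite mulg1 -[RHS]mul1g -(lawG x y Gx Gy) !mulgA.
Qed.

Lemma block_law_pr_centralized (gT : finGroupType) (G : {group gT}) p r :
    prime p -> prime r -> r != p -> law G ->
    (forall (rT : finGroupType) (L E : {group rT}) (abE : p.-abelem E)
      (ntE : E :!=: 1) (nEL : L \subset 'N(E)) h,
      E \subset L -> h \in L -> r.-elt h -> law L ->
      abelem_repr abE ntE nEL h = 1%R) ->
  pr_centralized p r G.
Proof.
move=> p_pr r_pr neq_rp lawG trivL X g sXG pX Ng rg.
have [-> | ntX] := eqVneq X 1%G; first exact: subsetP (cents1 setT) g (in_setT g).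
have [Gg NXg] := setIP Ng.
have sgN : <[g]> \subset 'N_G(X) by rewrite cycle_subG.
rewrite -cycle_subG; apply: (coprime_cent_Phi pX); first by rewrite cycle_subG.
  apply: (pnat_coprime pX); apply: pi_pnat rg _.
  by rewrite !inE.
have nPN : 'N_G(X) \subset 'N('Phi(X)).
  by rewrite (char_norm_trans (Phi_char X)) ?subsetIr.
have abE := Phi_quotient_abelem pX.
have ntE : X / 'Phi(X) != 1 by rewrite -subG1 quotient_sub1 ?gFnorm // proper_subn ?Phi_proper.
have nEL : 'N_G(X) / 'Phi(X) \subset 'N(X / 'Phi(X)) by rewrite quotient_norms ?subsetIr.
rewrite quotient_cycle ?(subsetP nPN) // cycle_subG.
apply: (abelem_repr_eq1 (abE := abE) (ntE := ntE) (nEL := nEL)); first by rewrite mem_quotient.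
apply: trivL; rewrite ?quotientS ?mem_quotient ?morph_p_elt ?(subsetP nPN) //.
  by rewrite subsetI sXG normG.
by apply: block_law_quotient; apply: block_lawS lawG; apply: subsetIl.
Qed.

End BlockLaw.

Lemma size_primes_le2 n : n <= 11 -> size (primes n) <= 2.
Proof. by do 12![case: n => [//|n]]. Qed.

Section BlockLawSolvable.

Variables (gT : finGroupType) (G : {group gT}) (a1 a2 a3 a4 : int).
Hypothesis sum_a : (a1 + a2 + a3 + a4 = 0)%R.
Hypothesis le_a : `|a1| + `|a2| + `|a3| + `|a4| <= 7.

Lemma alternating_block_law_sol :
  [/\ a1 != 0, a2 != 0, a3 != 0 & a4 != 0]%R ->
  block_law G 1 (-1) 1 (-1) a1 a2 a3 a4 -> solvable G.
Proof.
case=> a1_0 a2_0 a3_0 a4_0 lawG.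
have [a13 | a13] := eqVneq (a1 + a3)%R 0%R.
  apply: sol_odd_pr_centralized => p r p_pr r_pr neq_rp neq_r2.
  apply: (block_law_pr_centralized p_pr r_pr neq_rp lawG).
  move=> rT L E abE ntE nEL h sEL Lh rh lawL.
  have r_gt2 : 2 < r by have := prime_gt1 r_pr; lia.
  have r'small (a : int) : a != 0%R -> `|a| <= 2 -> ~~ (r %| `|a|).
    by move=> a0 le_a2; apply/negP => /dvdn_leq; lia.
  apply: (alternating_law_cent_r p_pr abE ntE sEL nEL Lh r_pr neq_rp rh sum_a) => //.
    by apply: r'small => //; lia.
  by apply: r'small => //; lia.
apply: (@sol_p_centralized_primes _ _ [pred p | ~~ (p %| `|(a1 + a3)%R|)]).
  move=> p p_pr p'a r r_pr neq_rp.
  apply: (block_law_pr_centralized p_pr r_pr neq_rp lawG).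
  move=> rT L E abE ntE nEL h sEL Lh rh lawL.
  exact: (alternating_law_cent_p p_pr abE ntE sEL nEL Lh sum_a).
apply: leq_trans (size_primes_le2 (_ : `|(a1 + a3)%R| <= 11)); last by lia.
apply: uniq_leq_size; first by rewrite filter_uniq ?primes_uniq.
move=> p; rewrite mem_filter !mem_primes inE negbK => /andP[-> /andP[-> _]].
by rewrite andbT /=; lia.
Qed.

Lemma paired_block_law_sol :
  (a2 != 0)%R -> block_law G 1 1 (-1) (-1) a1 a2 a3 a4 -> solvable G.
Proof.
move=> a2_0 lawG; apply: sol_odd_pr_centralized => p r p_pr r_pr neq_rp neq_r2.
apply: (block_law_pr_centralized p_pr r_pr neq_rp lawG).
move=> rT L E abE ntE nEL h sEL Lh rh lawL.
have [pa2 | p'a2] := boolP (p %| `|a2|); last first.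
  exact: (paired_law_cent_p p_pr abE ntE sEL nEL Lh r_pr neq_rp rh sum_a).
have [ra2 | r'a2] := boolP (r %| `|a2|); last first.
  exact: (paired_law_cent_r p_pr abE ntE sEL nEL Lh r_pr neq_rp rh sum_a).
have : p * r %| `|a2| by rewrite Gauss_dvd ?pa2 // prime_coprime // dvdn_prime2 // eq_sym.
move/dvdn_leq; have := prime_gt1 p_pr; have := prime_gt1 r_pr; nia.
Qed.

End BlockLawSolvable.

Definition sign_exponent (b : bool) : int := if b then (-1)%R else 1%R.

Lemma block_law_sol (gT : finGroupType) (G : {group gT}) (b1 b2 b3 b4 : bool)
    (a1 a2 a3 a4 : int) :
    (a1 + a2 + a3 + a4 = 0)%R -> `|a1| + `|a2| + `|a3| + `|a4| <= 7 ->
    (sign_exponent b1 + sign_exponent b2 + sign_exponent b3 + sign_exponent b4 = 0)%R ->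
    (b1 != b2 -> a1 != 0)%R -> (b2 != b3 -> a2 != 0)%R ->
    (b3 != b4 -> a3 != 0)%R -> (b4 != b1 -> a4 != 0)%R ->
    block_law G (sign_exponent b1) (sign_exponent b2) (sign_exponent b3)
      (sign_exponent b4) a1 a2 a3 a4 ->
  solvable G.
Proof.
move: b1 b2 b3 b4 => [] [] [] [] sum_a le_a //= _ a1_0 a2_0 a3_0 a4_0 law1;
  have law2 := block_law_rotation law1; have law3 := block_law_rotation law2;
  have law4 := block_law_rotation law3.
- by apply: paired_block_law_sol law3; [lia | lia | exact: a4_0].
- apply: alternating_block_law_sol law2; [lia | lia |].
  by split; [apply: a2_0 | apply: a3_0 | apply: a4_0 | apply: a1_0].
- by apply: paired_block_law_sol law2; [lia | lia | exact: a3_0].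
- by apply: paired_block_law_sol law4; [lia | lia | exact: a1_0].
- apply: alternating_block_law_sol law1; [lia | lia |].
  by split; [apply: a1_0 | apply: a2_0 | apply: a3_0 | apply: a4_0].
by apply: paired_block_law_sol law1; [lia | lia | exact: a2_0].
Qed.

Lemma exponent_sol (gT : finGroupType) (G : {group gT}) (a : int) :
  a != 0%R -> `|a| <= 11 -> (forall x, x \in G -> zexpg x a = 1) -> solvable G.
Proof.
move=> a0 le_a expG; apply: Burnside_p_a_q_b.
apply: leq_trans (size_primes_le2 le_a); apply: uniq_leq_size; first exact: primes_uniq.
move=> p; rewrite !mem_primes => /and3P[p_pr _ /(Cauchy p_pr)[x Gx ox]].
have xa1 : x ^+ `|a| = 1.
  case: a {a0 le_a} expG => n /(_ x Gx) //= /(congr1 invg).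
  by rewrite invgK invg1.
by rewrite p_pr -ox order_dvdn xa1 eqxx andbT /=; lia.
Qed.

(** * Reduced words *)

Section Words.

Variable d : nat.
Implicit Types (a b c : letter d) (s t u v : seq (letter d)) (i j k : 'I_d).

Definition seq_law (gT : finGroupType) (G : {set gT}) s : Prop :=
  forall g : 'I_d -> gT, (forall i, g i \in G) -> seq_eval g s = 1.

Definition noncancelling a b := b != letter_inv a.

Definition cyclically_reduced s := path.cycle noncancelling s.

Definition exponent_sum i s : int :=
  (\sum_(a <- s) if a.1 == i then sign_exponent a.2 else 0)%R.

Definition occurrences i s := count (fun a => a.1 == i) s.

Lemma exponent_sum_nil i : exponent_sum i [::] = 0%R.
Proof. exact: big_nil. Qed.

Lemma exponent_sum_cons i a s :
  exponent_sum i (a :: s) =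
  ((if a.1 == i then sign_exponent a.2 else 0) + exponent_sum i s)%R.
Proof. exact: big_cons. Qed.

Lemma exponent_sum_cat i s t :
  exponent_sum i (s ++ t) = (exponent_sum i s + exponent_sum i t)%R.
Proof. exact: big_cat. Qed.

Lemma exponent_sum_le i s : `|exponent_sum i s| <= occurrences i s.
Proof.
elim: s => [|a s]; rewrite ?exponent_sum_nil // exponent_sum_cons /=.
by case: eqP => _; case: (a.2) => /=; lia.
Qed.

Lemma exponent_sum_occurrences i s :
  exists n : nat, ((occurrences i s)%:Z = exponent_sum i s + n%:Z *+ 2)%R.
Proof.
elim: s => [|a s [n IHs]]; first by exists 0; rewrite exponent_sum_nil.
rewrite exponent_sum_cons /=; case: eqP => _; last by exists n; lia.
by case: (a.2) => /=; [exists n.+1 | exists n]; lia.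
Qed.

Lemma exponent_sum_reduced i a s :
  path noncancelling a s -> all (fun b => b.1 == i) (a :: s) ->
  exponent_sum i (a :: s) = (sign_exponent a.2 * (size s).+1%:Z)%R.
Proof.
elim: s a => [|b s IHs] a /=.
  by move=> _ /andP[/eqP ai _]; rewrite exponent_sum_cons exponent_sum_nil ai eqxx; lia.
case/andP=> ab pbs /and3P[/eqP ai /eqP bi si].
have eq_ab : b = a.
  case: a b ab ai bi {IHs pbs} => [a1 a2] [b1 b2] /= ab a1i b1i.
  rewrite /noncancelling /letter_inv /= a1i b1i in ab *.
  by congr pair; move: ab; case: a2 b2 => [] []; rewrite ?eqxx.
rewrite exponent_sum_cons IHs //= ?bi ?eqxx // eq_ab ai eqxx; lia.
Qed.

Lemma reduced_exponent_sum_neq0 i s :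
  sorted noncancelling s -> all (fun b => b.1 == i) s -> s != [::] ->
  exponent_sum i s != 0%R.
Proof.
case: s => // a s ps si _; rewrite (exponent_sum_reduced ps si).
by case: (a.2) => /=; lia.
Qed.

Lemma letter_eval_zexpg (gT : finGroupType) (g : 'I_d -> gT) a :
  letter_eval g a = zexpg (g a.1) (sign_exponent a.2).
Proof. by rewrite /letter_eval; case: (a.2) => /=; rewrite ?expg1. Qed.

Section Evaluation.

Variable gT : finGroupType.
Implicit Types (g : 'I_d -> gT) (G : {group gT}).

Lemma seq_eval_cat g s t : seq_eval g (s ++ t) = seq_eval g s * seq_eval g t.
Proof. exact: big_cat. Qed.

Lemma seq_eval_in g G s : (forall i, g i \in G) -> seq_eval g s \in G.
Proof.
move=> Gg; elim: s => [|a s IHs]; first by rewrite /seq_eval big_nil group1.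
by rewrite seq_eval_cons groupM // letter_eval_zexpg zexpg_in.
Qed.

Lemma eq_seq_eval g g' s :
  (forall a, a \in s -> g a.1 = g' a.1) -> seq_eval g s = seq_eval g' s.
Proof. by move=> eq_g; apply: eq_big_seq => a /eq_g; rewrite /letter_eval => ->. Qed.

Lemma seq_eval_single g i s :
  (forall a, a \in s -> a.1 != i -> g a.1 = 1) ->
  seq_eval g s = zexpg (g i) (exponent_sum i s).
Proof.
elim: s => [|a s IHs] g1; first by rewrite /seq_eval big_nil exponent_sum_nil.
rewrite seq_eval_cons exponent_sum_cons zexpgD IHs; last first.
  by move=> b sb; apply: g1; rewrite inE sb orbT.
congr (_ * _); rewrite letter_eval_zexpg; case: eqP => [-> // | /eqP ai].
by rewrite g1 ?mem_head // zexp1g.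
Qed.

Lemma seq_law_catC G s t : seq_law G (s ++ t) -> seq_law G (t ++ s).
Proof.
move=> lawG g Gg; have := lawG g Gg; rewrite !seq_eval_cat.
by move/(canRL (mulgK _)); rewrite mul1g => ->; rewrite mulgV.
Qed.

Lemma seq_law_exponent_sol G s i :
  seq_law G s -> size s <= 11 -> exponent_sum i s != 0%R -> solvable G.
Proof.
move=> lawG le_s s_neq0; apply: (exponent_sol s_neq0).
  exact: leq_trans (exponent_sum_le i s) (leq_trans (count_size _ _) le_s).
move=> x Gx; pose g k := if k == i then x else 1.
have := lawG g; rewrite (@seq_eval_single g i) /g ?eqxx; last by move=> a _ /negPf ->.
by apply=> k; case: eqP.
Qed.

Lemma seq_law_quotient_center G s :
  (forall g, (forall i, g i \in G) -> seq_eval g s \in 'Z(G)) ->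
  seq_law (G / 'Z(G)) s.
Proof.
move=> centG h Gh; have nZG := normal_norm (center_normal G).
pose g i := repr (h i).
have Gg i : g i \in G.
  have /morphimP[x Nx Gx def_h] := Gh i; have := mem_repr_coset (h i).
  rewrite def_h val_coset // => /rcosetP[z Zz def_x].
  rewrite /g def_h val_coset // def_x groupM //; exact: subsetP (center_sub G) z Zz.
have -> : seq_eval h s = coset 'Z(G) (seq_eval g s).
  elim: (s) => [|a t IHt]; first by rewrite /seq_eval !big_nil morph1.
  rewrite !seq_eval_cons IHt morphM ?(subsetP nZG) ?seq_eval_in //; last first.
    by rewrite letter_eval_zexpg zexpg_in.
  rewrite [in LHS]letter_eval_zexpg; congr (_ * _); rewrite -[h a.1]coset_reprK.
  rewrite -(morph_zexpg (coset_morphism 'Z(G))); first by rewrite letter_eval_zexpg.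
  exact: repr_coset_norm.
exact: coset_id (centG g Gg).
Qed.

End Evaluation.

Lemma split_first (P : pred (letter d)) s :
  0 < count P s -> exists t a u,
  [/\ s = t ++ a :: u, P a, count P t = 0 & count P u = (count P s).-1].
Proof.
elim: s => //= b s IHs; have [Pb _ | nPb] := boolP (P b).
  by exists [::], b, s; rewrite Pb add1n.
rewrite add0n => /IHs[t [a [u [-> Pa t0 u0]]]].
by exists (b :: t), a, u; rewrite /= (negPf nPb) t0 u0.
Qed.

Lemma rotate_to i s : 0 < occurrences i s -> cyclically_reduced s ->
  exists a t, [/\ a.1 = i, cyclically_reduced (a :: t), perm_eq s (a :: t) &
    forall (gT : finGroupType) (G : {group gT}), seq_law G s -> seq_law G (a :: t)].
Proof.
case/split_first=> u [a [v [-> /eqP ai _ _]]] cyc_s; exists a, (v ++ u).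
have rot_s : seq.rot (size u) (u ++ a :: v) = a :: v ++ u by rewrite rot_size_cat.
split=> // [||gT G].
- by rewrite /cyclically_reduced -rot_s rot_cycle.
- by rewrite -rot_s perm_sym perm_rot.
by rewrite -cat_cons; apply: seq_law_catC.
Qed.

Lemma notin_occurrences0 i s : occurrences i s = 0 -> forall a, a \in s -> a.1 != i.
Proof.
move=> s0 a sa; apply: contra_eqN s0 => ai; rewrite -lt0n -has_count.
by apply/hasP; exists a.
Qed.

Lemma exponent_sum_absent i s : occurrences i s = 0 -> exponent_sum i s = 0%R.
Proof. by move=> s0; have := exponent_sum_le i s; rewrite s0; lia. Qed.

Lemma exponent_sum_perm i s t : perm_eq s t -> exponent_sum i s = exponent_sum i t.
Proof. exact: perm_big. Qed.

Lemma noncancelling_signs a b :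
  a.1 = b.1 -> a.2 != b.2 -> ~~ noncancelling a b.
Proof.
case: a b => [i x] [j y] /= -> xy; rewrite negbK /letter_inv /=.
by apply/eqP; congr pair; case: x y xy => [] [].
Qed.

Lemma block_exponent_neq0 i j a b u :
  a.1 = i -> b.1 = i -> all (fun c => c.1 == j) u ->
  path noncancelling a (rcons u b) -> (a.2 != b.2 -> exponent_sum j u != 0)%R.
Proof.
move=> ai bi uj p_aub ab; apply: reduced_exponent_sum_neq0 => //.
  by move: p_aub; rewrite rcons_path => /andP[/path_sorted].
apply: contraTneq p_aub => ->; rewrite /= andbT; apply: noncancelling_signs => //.
by rewrite ai bi.
Qed.

Lemma four_occurrences_sol (gT : finGroupType) (G : {group gT}) i j s :
    i != j -> cyclically_reduced s -> all (fun a => (a.1 == i) || (a.1 == j)) s ->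
    occurrences i s = 4 -> size s <= 11 ->
    exponent_sum i s = 0%R -> exponent_sum j s = 0%R -> seq_law G s ->
  solvable G.
Proof.
move=> neq_ij cyc_s s_ij occ_s le_s s_i s_j law_s.
have [a1 [t [a1i cyc_t st law_t]]] : exists a t, [/\ a.1 = i, cyclically_reduced (a :: t),
    perm_eq s (a :: t) & seq_law G s -> seq_law G (a :: t)].
  have [|a [t [ai cyc_t st lawst]]] := @rotate_to i s _ cyc_s; first by rewrite occ_s.
  by exists a, t; split=> //; apply: lawst.
move/(_ law_s): law_t => law_t; rewrite (perm_all _ st) in s_ij.
rewrite (perm_size st) in le_s.
rewrite (exponent_sum_perm i st) in s_i; rewrite (exponent_sum_perm j st) in s_j.
have occ_t : occurrences i t = 3.
  by move: occ_s; rewrite /occurrences (seq.permP st) /= a1i eqxx => -[].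
have [|y1 [a2 [t2 [def_t /eqP a2i y1_i]]]] := @split_first (fun a => a.1 == i) t.
  by rewrite -/(occurrences i t) occ_t.
rewrite -/(occurrences i t) occ_t => occ_t2.
have [|y2 [a3 [t3 [def_t2 /eqP a3i y2_i]]]] := @split_first (fun a => a.1 == i) t2.
  by rewrite occ_t2.
rewrite occ_t2 => occ_t3.
have [|y3 [a4 [y4 [def_t3 /eqP a4i y3_i]]]] := @split_first (fun a => a.1 == i) t3.
  by rewrite occ_t3.
rewrite occ_t3 => y4_i.
subst t t2 t3.
have only_j y : occurrences i y = 0 -> {subset y <= a1 :: y1 ++ a2 :: y2 ++ a3 :: y3 ++ a4 :: y4} ->
    all (fun a => a.1 == j) y.
  move=> y_i sy; apply/allP=> a ya; have := allP s_ij a (sy a ya).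
  by rewrite (negPf (notin_occurrences0 y_i ya)).
have j1 : all (fun a => a.1 == j) y1.
  by apply: only_j => // a ya; rewrite inE mem_cat ya orbT.
have j2 : all (fun a => a.1 == j) y2.
  by apply: only_j => // a ya; rewrite inE mem_cat inE mem_cat ya !orbT.
have j3 : all (fun a => a.1 == j) y3.
  by apply: only_j => // a ya; rewrite inE mem_cat inE mem_cat inE mem_cat ya !orbT.
have j4 : all (fun a => a.1 == j) y4.
  by apply: only_j => // a ya; rewrite inE mem_cat inE mem_cat inE mem_cat inE ya !orbT.
move: cyc_t; rewrite /cyclically_reduced /= !rcons_cat /= !rcons_cat /= !rcons_cat /=.
rewrite -!cat_rcons !cat_path !last_rcons => /and4P[p1 p2 p3 p4].
have n1 := block_exponent_neq0 a1i a2i j1 p1.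
have n2 := block_exponent_neq0 a2i a3i j2 p2.
have n3 := block_exponent_neq0 a3i a4i j3 p3.
have n4 := block_exponent_neq0 a4i a1i j4 p4.
apply: (block_law_sol (b1 := a1.2) (b2 := a2.2) (b3 := a3.2) (b4 := a4.2)
  _ _ _ n1 n2 n3 n4).
- move: s_j; rewrite !(exponent_sum_cons, exponent_sum_cat) a1i a2i a3i a4i.
  by rewrite (negPf neq_ij) !GRing.add0r !GRing.addrA.
- move: le_s; rewrite /= !size_cat /= !size_cat /= !size_cat /=.
  have le y := leq_trans (exponent_sum_le j y) (count_size _ y).
  by move: (le y1) (le y2) (le y3) (le y4); clear; lia.
- move: s_i; rewrite !(exponent_sum_cons, exponent_sum_cat) a1i a2i a3i a4i eqxx.
  by rewrite !(exponent_sum_absent (i := i)) // !GRing.add0r GRing.addr0 !GRing.addrA.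
move=> x y Gx Gy; pose g k := if k == i then x else y.
have Gg k : g k \in G by rewrite /g; case: ifP.
have y_eval u : occurrences i u = 0 -> all (fun a => a.1 == j) u ->
    seq_eval g u = zexpg y (exponent_sum j u).
  move=> u_i uj; rewrite (@seq_eval_single _ g j) => [|a ua]; last first.
    by rewrite (eqP (allP uj a ua)) eqxx.
  by rewrite /g eq_sym (negPf neq_ij).
rewrite -!y_eval //.
have x_eval a : a.1 = i -> zexpg x (sign_exponent a.2) = letter_eval g a.
  by move=> ai; rewrite letter_eval_zexpg ai /g eqxx.
rewrite !x_eval // -[RHS](law_t g Gg).
by rewrite !(seq_eval_cons, seq_eval_cat) !mulgA.
Qed.

Lemma two_occurrences_center (gT : finGroupType) (G : {group gT}) a b u v i :
    a.1 = i -> b.1 = i -> a.2 != b.2 -> occurrences i u = 0 -> occurrences i v = 0 ->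
    seq_law G (a :: u ++ b :: v) ->
  seq_law (G / 'Z(G)) u.
Proof.
move=> ai bi ab u_i v_i lawG; apply: seq_law_quotient_center => g Gg.
have bE (h : 'I_d -> gT) : letter_eval h b = (letter_eval h a)^-1.
  by rewrite -letter_evalV; move/noncancelling_signs: ab; rewrite ai bi negbK => /(_ erefl)/eqP->.
pose gx x k := if k == i then x else g k.
have Ggx x k : x \in G -> gx x k \in G by rewrite /gx; case: ifP.
have evalx w x : occurrences i w = 0 -> seq_eval (gx x) w = seq_eval g w.
  move=> w_i; apply: eq_seq_eval => c wc.
  by rewrite /gx (negPf (notin_occurrences0 w_i wc)).
have lawx x : x \in G ->
    letter_eval (gx x) a * seq_eval g u * (letter_eval (gx x) a)^-1 * seq_eval g v = 1.
  move=> Gx; rewrite -(lawG (gx x)) => [|k]; last exact: Ggx.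
  by rewrite seq_eval_cons seq_eval_cat seq_eval_cons bE !evalx // !mulgA.
have uv : seq_eval g u * seq_eval g v = 1.
  have := lawx 1 (group1 G); rewrite letter_eval_zexpg /gx ai eqxx zexp1g.
  by rewrite invg1 mulg1 mul1g.
rewrite inE seq_eval_in //=; apply/centP=> x Gx; apply: commute_sym.
have : commute (zexpg x (sign_exponent a.2)) (seq_eval g u).
  have := lawx x Gx; rewrite -[in RHS]uv letter_eval_zexpg /gx ai eqxx.
  by move/mulIg/(canRL (mulgKV _)).
by case: (a.2) => //= /commute_sym/commuteV; rewrite invgK => /commute_sym.
Qed.

Lemma count_disjoint3 (P Q R : pred (letter d)) s :
  (forall a, P a + Q a + R a <= 1) -> count P s + count Q s + count R s <= size s.
Proof.
by move=> disj; elim: s => //= a s IHs; have := disj a; lia.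
Qed.

Lemma noncancelling_refl a : noncancelling a a.
Proof. by apply/eqP => /(congr1 snd) /=; case: (a.2). Qed.

Lemma short_law_sol n s (gT : finGroupType) (G : {group gT}) :
  size s <= n -> n <= 11 -> reduced s -> s != [::] -> seq_law G s -> solvable G.
Proof.
move=> + le_n; elim: n le_n s gT G => [|n IHn] le_n s gT G le_s red_s s_n0 law_s.
  by case: s le_s s_n0 {red_s law_s}.
have {}IHn := IHn (ltnW le_n).
have le_s11 := leq_trans le_s le_n.
have [/hasP[i _ s_i] | s_i] := boolP (has (fun i => exponent_sum i s != 0%R) (enum 'I_d)).
  exact: seq_law_exponent_sol law_s le_s11 s_i.
have {}s_i i : exponent_sum i s = 0%R.
  by apply/eqP; apply: contraNT s_i => s_i; apply/hasP; exists i; rewrite ?mem_enum.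
have [cyc_s | ncyc_s] := boolP (cyclically_reduced s); last first.
  case: s ncyc_s red_s le_s law_s {s_n0 s_i le_s11} => // a s.
  case/lastP: s => [|s b]; first by rewrite /cyclically_reduced /= noncancelling_refl.
  rewrite /cyclically_reduced /= rcons_path last_rcons => + red_s.
  have -> : path noncancelling a (rcons s b) by []; rewrite negbK => /eqP def_a.
  rewrite {}def_a in red_s *; rewrite size_rcons => le_s law_s.
  apply: (IHn s) => //; first by move: le_s; clear; lia.
  - by move: red_s; rewrite /reduced /= rcons_path => /andP[/path_sorted].
  - by apply: contraTneq red_s => ->; rewrite /reduced /= letter_invK eqxx.
  move=> g Gg; have := law_s g Gg.
  rewrite seq_eval_cons -cats1 seq_eval_cat seq_eval_cons letter_evalV.
  rewrite [seq_eval g [::]]big_nil mulg1 mulgA => /(canRL (mulgK _)).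
  by rewrite mul1g -[RHS]mulg1 => /mulgI.
have occ_even i : exists m, occurrences i s = m.*2.
  have [m] := exponent_sum_occurrences i s; rewrite s_i => occ_m.
  by exists m; move: occ_m; clear; lia.
have [/hasP[i _ /eqP occ2] | no2] := boolP (has (fun i => occurrences i s == 2) (enum 'I_d)).
  have [|a [t [ai cyc_t st law_t]]] := @rotate_to i s _ cyc_s; first by rewrite occ2.
  have occ_t : occurrences i t = 1%N.
    by move: occ2; rewrite /occurrences (seq.permP st) /= ai eqxx => -[].
  have [|u [b [v [def_t /eqP bi u_i]]]] := @split_first (fun a => a.1 == i) t.
    by rewrite -/(occurrences i t) occ_t.
  rewrite -/(occurrences i t) occ_t => v_i; subst t.
  have ab : a.2 != b.2.
    have := s_i i; rewrite (exponent_sum_perm i st).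
    rewrite !(exponent_sum_cons, exponent_sum_cat) ai bi eqxx.
    rewrite !(exponent_sum_absent (i := i)) //; case: (a.2) (b.2) => [] [] //=.
  have lawu := two_occurrences_center ai bi ab u_i v_i (law_t _ _ law_s).
  have solQ : solvable (G / 'Z(G)).
    apply: IHn lawu; first by move: le_s; rewrite (perm_size st) /= size_cat /=; clear; lia.
      move: cyc_t; rewrite /cyclically_reduced /= rcons_cat cat_path.
      by case/andP => /path_sorted.
    apply: contraTneq cyc_t => ->; rewrite /cyclically_reduced /=.
    by rewrite (negPf (noncancelling_signs _ ab)) ?ai ?bi.
  by rewrite (series_sol (center_normal G)) solQ abelian_sol // center_abelian.
have occ_ge4 a : a \in s -> 4 <= occurrences a.1 s.
  move=> sa; have : 0 < occurrences a.1 s by rewrite -has_count; apply/hasP; exists a.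
  have : occurrences a.1 s != 2.
    by apply: contraNneq no2 => occ2; apply/hasP; exists a.1; rewrite ?mem_enum ?occ2.
  by have [m ->] := occ_even a.1; move: m; clear; lia.
case def_s : s s_n0 => [|a s'] // _; have sa : a \in s by rewrite def_s mem_head.
have [all_i | /allPn[b sb bi]] := boolP (all (fun b => b.1 == a.1) s).
  have := reduced_exponent_sum_neq0 red_s all_i; rewrite def_s => /(_ isT).
  by rewrite -def_s s_i eqxx.
have s_ij : all (fun c => (c.1 == a.1) || (c.1 == b.1)) s.
  apply/allP=> c sc; apply: contraT; rewrite negb_or => /andP[ca cb].
  have disj (e : letter d) : (e.1 == a.1) + (e.1 == b.1) + (e.1 == c.1) <= 1.
    case: (eqVneq e.1 a.1) => [->|_]; first by rewrite eq_sym (negPf bi) eq_sym (negPf ca).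
    by case: (eqVneq e.1 b.1) => [->|_]; rewrite ?[b.1 == _]eq_sym ?(negPf cb) //; case: eqP.
  have le12 := leq_add (leq_add (occ_ge4 a sa) (occ_ge4 b sb)) (occ_ge4 c sc).
  by have := leq_trans le12 (leq_trans (count_disjoint3 s disj) le_s11).
have occ_ab : occurrences a.1 s + occurrences b.1 s <= size s.
  have disj (e : letter d) : (e.1 == a.1) + (e.1 == b.1) + pred0 e <= 1.
    by case: (eqVneq e.1 a.1) => [->|_]; [rewrite eq_sym (negPf bi) | case: eqP].
  by have := count_disjoint3 s disj; rewrite count_pred0 addn0.
have [occ_a | occ_b] : occurrences a.1 s = 4 \/ occurrences b.1 s = 4.
  have [m Em] := occ_even a.1; have [k Ek] := occ_even b.1.
  move: (occ_ge4 a sa) (occ_ge4 b sb) occ_ab le_s11; rewrite Em Ek.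
  by move: (size s); clear; lia.
  by apply: (four_occurrences_sol (i := a.1) (j := b.1) _ cyc_s) => //; rewrite eq_sym.
apply: (four_occurrences_sol (i := b.1) (j := a.1) _ cyc_s) => //.
by apply: sub_all s_ij => c; rewrite orbC.
Qed.

End Words.

Lemma sol_nonsolvable_length (gT : finGroupType) (G : {group gT}) :
  solvable G -> nonsolvable_length G = 0.
Proof.
move=> solG; apply/eqP; rewrite -leqn0 /nonsolvable_length.
case: ex_minnP => n _; apply; apply/asboolP; exists [:: G].
  split=> //; first by rewrite /= /invariant_factor norms1 normG normal1.
  by move=> HK; rewrite inE => /eqP->; left; rewrite quotient_sol.
by rewrite /nonsolvable_factors /= quotient_sol.
Qed.

Theorem corollary1p9 (d : nat) (w : free_group d) :
  w <> 1%g -> (word_length w <= 11)%N ->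
  exists L : nat, forall (gT : finGroupType) (G : {group gT}),
    satisfies_identity G w -> (nonsolvable_length G <= L)%N.
Proof.
move=> w_neq1 le_w; exists 0 => gT G idG.
rewrite sol_nonsolvable_length //.
apply: (short_law_sol le_w (leqnn 11) (free_wordP w) _ idG).
by apply/eqP => w0; apply/w_neq1/val_inj.
Qed.
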